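(* Let $\mathcal{A}\in\mathbb{R}^{\ell\times p\times n}$ and suppose that $m\le\min\{\ell,p\}$ steps of the tensor Lanczos bidiagonalization algorithm have been applied to $\mathcal{A}$, giving $\mathcal{P}_m,\mathcal{Q}_m,\mathcal{B}_m,\vec{\mathcal{R}}_m$ with $$\mathcal{A}\star\mathcal{P}_m=\mathcal{Q}_m\star\mathcal{B}_m,\qquad \mathcal{A}^H\star\mathcal{Q}_m=\mathcal{P}_m\star\mathcal{B}_m^H+\vec{\mathcal{R}}_m\star\vec{\mathcal{E}}_m^H$$ (properties listed in the context). Assume that the tensor $\mathcal{B}_m$ is invertible. Then for each $k=1,\dots,m-1$ there exist $\check{\mathcal{P}}_{k+1}\in\mathbb{R}^{p\times(k+1)\times n}$ and $\check{\mathcal{Q}}_{k+1}\in\mathbb{R}^{\ell\times(k+1)\times n}$ with orthonormal lateral slices, an upper triangular tensor $\check{\mathcal{B}}_{k+1}\in\mathbb{R}^{(k+1)\times(k+1)\times n}$, a tube $\check{\bm{\beta}}_{k+1}\in\mathbb{R}^{1\times1\times n}$ and a lateral slice $\vec{\check{\mathcal{P}}}_{k+2}\in\mathbb{R}^{p\times1\times n}$ orthogonal to $\check{\mathcal{P}}_{k+1}$ such that $$\mathcal{A}\star\check{\mathcal{P}}_{k+1}=\check{\mathcal{Q}}_{k+1}\star\check{\mathcal{B}}_{k+1},$$ $$\mathcal{A}^H\star\check{\mathcal{Q}}_{k+1}=\check{\mathcal{P}}_{k+1}\star\check{\mathcal{B}}_{k+1}^H+\check{\bm{\beta}}_{k+1}\star\vec{\check{\mathcal{P}}}_{k+2}\star\vec{\mathcal{E}}_{k+1}^H,$$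 and such that each of the first $k$ lateral slices of $\check{\mathcal{P}}_{k+1}$ is a t-linear combination of the first $k$ harmonic Ritz lateral slices $\vec{\check{\mathcal{V}}}_1,\dots,\vec{\check{\mathcal{V}}}_k$ of $\mathcal{A}$.
   Context: Third-order real tensors $\mathcal{A}\in\mathbb{R}^{\ell\times p\times n}$ have frontal slices $\mathcal{A}^{(k)}=\mathcal{A}(:,:,k)$. Elements of $\mathbb{R}^{\ell\times 1\times n}$ are called lateral slices and elements of $\mathbb{R}^{1\times1\times n}$ are called tubes. $\widehat{\mathcal{A}}$ denotes the tensor obtained by applying the (unnormalized) discrete Fourier transform of length $n$ to each tube $\mathcal{A}(i,j,:)$. The t-product $\mathcal{C}=\mathcal{A}\star\mathcal{B}$ of $\mathcal{A}\in\mathbb{R}^{\ell\times q\times n}$ and $\mathcal{B}\in\mathbb{R}^{q\times p\times n}$ is the tensor in $\mathbb{R}^{\ell\times p\times n}$ with $\widehat{\mathcal{C}}^{(i)}=\widehat{\mathcal{A}}^{(i)}\widehat{\mathcal{B}}^{(i)}$, $i=1,\dots,n$. The product of a tensor and a tube $\bm b$ multiplies each $\widehat{\mathcal{A}}^{(i)}$ by the scalar $\widehat{\bm b}^{(i)}$, and $\bm b\star\mathcal{A}=\mathcal{A}\star\bm b$. The transpose $\mathcal{A}^H$ is obtained by transposing all frontal slices and reversing the order of slices $2,\dots,n$ (so the frontal slices of $\widehat{\mathcal{A}^H}$ are the conjugate transposes of those of $\widehat{\mathcal{A}}$). The identity tensor $\mathcal{I}_m$ has first frontal slice $I_m$ and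 the others zero; $\mathcal{B}\in\mathbb{R}^{m\times m\times n}$ is invertible if some $\mathcal{B}^{-1}$ satisfies $\mathcal{B}\star\mathcal{B}^{-1}=\mathcal{B}^{-1}\star\mathcal{B}=\mathcal{I}_m$. $\vec{\mathcal{E}}_j\in\mathbb{R}^{j\times1\times n}$ (canonical lateral slice) has all entries zero except the first entry of its $j$th tube, which is $1$. Lateral slices $\vec{\mathcal{X}},\vec{\mathcal{Y}}$ are orthogonal if $\vec{\mathcal{X}}^H\star\vec{\mathcal{Y}}=0$; a tensor $\mathcal{X}$ with $j$ lateral slices has orthonormal lateral slices iff $\mathcal{X}^H\star\mathcal{X}=\mathcal{I}_j$. A t-linear combination of lateral slices $\vec{\mathcal{X}}_1,\dots,\vec{\mathcal{X}}_k$ is $\sum_{i=1}^k\vec{\mathcal{X}}_i\star\bm b_i$ with tubes $\bm b_i$. A tensor is upper triangular if its tubes $(i,j)$ with $i>j$ vanish. Output of $m$ steps of tensor Lanczos bidiagonalization (run without breakdown): $\mathcal{P}_m\in\mathbb{R}^{p\times m\times n}$ and $\mathcal{Q}_m\in\mathbb{R}^{\ell\times m\times n}$ with orthonormal lateral slices, $\vec{\mathcal{R}}_m\in\mathbb{R}^{p\times1\times n}$ with $\mathcal{P}_m^H\star\vec{\mathcal{R}}_m=0$, and $\mathcal{B}_m\in\mathbb{R}^{m\times m\times n}$ upper bidiagonal (only the tubes $(i,i)$ and $(i,i+1)$ may be nonzero), satisfying the two relations displayed first in the claim. The tube $\bm{\beta}_m$ is defined by $\widehat{\bm{\beta}}_m^{(i)}=\|\widehat{\vec{\mathcal{R}}}_m^{(i)}\|_2$,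 and $\mathcal{B}_{m,m+1}=[\mathcal{B}_m,\ \bm{\beta}_m\star\vec{\mathcal{E}}_m]\in\mathbb{R}^{m\times(m+1)\times n}$ is $\mathcal{B}_m$ with one lateral slice appended. Harmonic Ritz lateral slices (for $\mathcal{B}_m$ invertible): let $\{\bm s_i',\vec{\mathcal{U}}_i',\vec{\mathcal{V}}_i'\}_{i=1}^m$ be the singular triplets of $\mathcal{B}_{m,m+1}$ obtained from a t-SVD (i.e. real tensors whose Fourier-domain frontal slices give a matrix SVD of each $\widehat{\mathcal{B}}_{m,m+1}^{(i)}$, with nonnegative singular values), ordered so that the smallest come first (in each Fourier component the singular values are nondecreasing in the index). Thus $\mathcal{B}_{m,m+1}\star\vec{\mathcal{V}}_j'=\vec{\mathcal{U}}_j'\star\bm s_j'$ and $\mathcal{B}_{m,m+1}^H\star\vec{\mathcal{U}}_j'=\vec{\mathcal{V}}_j'\star\bm s_j'$. The $j$th harmonic Ritz lateral slice of $\mathcal{A}$ is $\vec{\check{\mathcal{V}}}_j=\mathcal{P}_m\star\mathcal{B}_m^{-1}\star\vec{\mathcal{U}}_j'$. *)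

(* Defs.v *)
From HB Require Import structures.
From mathcomp Require Import all_boot all_order all_algebra.
From mathcomp Require Import all_classical all_reals all_analysis.
From mathcomp Require Import complex ring lra.
Set Implicit Arguments.
Unset Strict Implicit.
Unset Printing Implicit Defensive.
Import Order.TTheory GRing.Theory Num.Theory.
Local Open Scope ring_scope.
Local Open Scope complex_scope.
Local Open Scope sesquilinear_scope.

(* A third-order tensor in K^(l x p x N), given by its N frontal slices.
   Indices are 0-based. The operations below take N = n.+1, so that the slice
   index type 'I_n.+1 carries addition modulo n.+1. *)
Definition tensor (K : Type) (l p N : nat) := {ffun 'I_N -> 'M[K]_(l, p)}.

Definition omega (R : realType) (n : nat) : R[i] :=
  cos (pi *+ 2 / n.+1%:R) -i* sin (pi *+ 2 / n.+1%:R).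

Definition dft (R : realType) l p n (A : tensor R l p n.+1) :
    tensor R[i] l p n.+1 :=
  [ffun k : 'I_n.+1 => \sum_(j < n.+1)
     omega R n ^+ (j * k) *: map_mx (fun x : R => x%:C) (A j)].

(* Inverse transform. Taking the real part only serves to land in the real
   tensors: on data H with the conjugate symmetry H (- k) = conj (H k) that the
   transform of a real tensor has, nothing is lost (see [idftK]). *)
Definition idft (R : realType) l p n (H : tensor R[i] l p n.+1) :
    tensor R l p n.+1 :=
  [ffun k : 'I_n.+1 => map_mx (@complex.Re R) (n.+1%:R^-1 *:
     \sum_(j < n.+1) (omega R n ^+ (j * k))^-1 *: H j)].

Definition tprod (R : realType) l q p n
    (A : tensor R l q n.+1) (B : tensor R q p n.+1) : tensor R l p n.+1 :=
  idft [ffun i : 'I_n.+1 => dft A i *m dft B i].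

Definition tubeprod (R : realType) l p n
    (b : tensor R 1 1 n.+1) (A : tensor R l p n.+1) : tensor R l p n.+1 :=
  idft [ffun i : 'I_n.+1 => dft b i 0 0 *: dft A i].

(* [- k] is negation modulo n.+1: slice 0 stays, the others are reversed. *)
Definition ttrans (R : realType) l p n (A : tensor R l p n.+1) :
    tensor R p l n.+1 :=
  [ffun k : 'I_n.+1 => (A (- k))^T].

Definition tid (R : realType) m n : tensor R m m n.+1 :=
  [ffun k : 'I_n.+1 => if k == 0 then 1%:M else 0].

Definition is_tinv (R : realType) m n (B Binv : tensor R m m n.+1) : Prop :=
  tprod B Binv = tid R m n /\ tprod Binv B = tid R m n.

(* The canonical lateral slice of size j x 1 x (n+1): the only nonzero entry
   is in its last tube. *)
Definition tE (R : realType) j n : tensor R j 1 n.+1 :=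
  [ffun k : 'I_n.+1 =>
     \matrix_(i < j, _ < 1) ((k == 0) && (i.+1 == j :> nat))%:R].

Definition lateral (R : realType) l p n (j : 'I_p) (A : tensor R l p n.+1) :
    tensor R l 1 n.+1 :=
  [ffun k : 'I_n.+1 => col j (A k)].

Definition trow (R : realType) l p q n
    (A : tensor R l p n.+1) (B : tensor R l q n.+1) :
    tensor R l (p + q) n.+1 :=
  [ffun k : 'I_n.+1 => row_mx (A k) (B k)].

Definition torthonormal (R : realType) l j n (X : tensor R l j n.+1) : Prop :=
  tprod (ttrans X) X = tid R j n.

Definition torthogonal (R : realType) l j n
    (X : tensor R l j n.+1) (Y : tensor R l 1 n.+1) : Prop :=
  tprod (ttrans X) Y = 0.

Definition is_tlincomb (R : realType) l k n
    (X : 'I_k -> tensor R l 1 n.+1) (Y : tensor R l 1 n.+1) : Prop :=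
  exists b : 'I_k -> tensor R 1 1 n.+1, Y = \sum_(i < k) tubeprod (b i) (X i).

Definition upper_triangular (R : realType) m n (B : tensor R m m n.+1) : Prop :=
  forall (i j : 'I_m) (q : 'I_n.+1), (j < i)%N -> B q i j = 0.

Definition upper_bidiagonal (R : realType) m n (B : tensor R m m n.+1) : Prop :=
  forall (i j : 'I_m) (q : 'I_n.+1),
    j != i :> nat -> j != i.+1 :> nat -> B q i j = 0.

Definition norm2 (R : realType) l (v : 'cV[R[i]]_l) : R[i] :=
  sqrtC (\sum_(i < l) `|v i 0| ^+ 2).

Definition is_svd (R : realType) m p (M : 'M[R[i]]_(m, p))
    (U : 'M[R[i]]_m) (S : 'M[R[i]]_(m, p)) (V : 'M[R[i]]_p) : Prop :=
  [/\ U \is unitarymx, V \is unitarymx, is_diag_mx S,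
      forall i j, 0 <= S i j & M = U *m S *m V ^t*].

Definition is_tsvd (R : realType) m p n (B : tensor R m p n.+1)
    (U : tensor R m m n.+1) (S : tensor R m p n.+1)
    (V : tensor R p p n.+1) : Prop :=
  forall i : 'I_n.+1, is_svd (dft B i) (dft U i) (dft S i) (dft V i).

(* For S of size m x (m + 1), the tube of the j-th singular triplet is
   S (j, j, :) and [lshift 1 j] is j viewed as a column index. *)
Definition smallest_first (R : realType) m n
    (S : tensor R m (m + 1) n.+1) : Prop :=
  forall (i : 'I_n.+1) (j j' : 'I_m), (j <= j')%N ->
    dft S i j (lshift 1 j) <= dft S i j' (lshift 1 j').

Definition harmonic_ritz (R : realType) p m n
    (P : tensor R p m n.+1) (Binv U : tensor R m m n.+1) (j : 'I_m) :
    tensor R p 1 n.+1 :=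
  tprod (tprod P Binv) (lateral j U).

Section DftFacts.
Variables (R : realType) (n : nat).
Local Notation w := (omega R n).
Local Notation N := n.+1.
#[local] Arguments omega : simpl never.

Lemma omegaX k : w ^+ k =
  cos (pi *+ 2 / N%:R *+ k) -i* sin (pi *+ 2 / N%:R *+ k).
Proof.
elim: k => [|k IH]; first by rewrite expr0 !mulr0n cos0 sin0 oppr0.
rewrite exprS IH /omega; set t := _ / _.
rewrite mulrS cosD sinD; apply/eqP; rewrite eq_complex /=.
by apply/andP; split; apply/eqP; ring.
Qed.

Lemma omega_prim : N.-primitive_root w.
Proof.
have N0 : (N%:R : R) != 0 by rewrite pnatr_eq0.
apply/andP; split => //; apply/forallP => i; apply/eqP.
rewrite unity_rootE; apply/eqP/eqP => [|->]; last first.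
  by rewrite omegaX -[_ *+ N]mulr_natr divfK // cos2pi sin2pi oppr0.
rewrite omegaX; set x := _ *+ i.+1 => -[cx _].
have := ltn_ord i; rewrite leq_eqVlt => /predU1P[//|ltiN]; exfalso.
have xE : x = (x / 2) *+ 2 by rewrite -mulr_natr divfK // pnatr_eq0.
have y_gt0 : 0 < x / 2 < pi.
  rewrite divr_gt0 ?ltr0n //=; last first.
    by rewrite pmulrn_lgt0 // divr_gt0 ?ltr0n // pmulrn_lgt0 // pi_gt0.
  rewrite ltr_pdivrMr ?ltr0n // mulr_natr /x -mulr_natr mulrAC.
  rewrite ltr_pdivrMr ?ltr0n // ltr_pM2l ?ltr_nat //.
  by rewrite pmulrn_lgt0 // pi_gt0.
have := sin_gt0_pi y_gt0.
have : sin (x / 2) ^+ 2 = 0.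
  by rewrite sin2cos2; move: cx; rewrite {1}xE cos_mulr2n; lra.
by move=> /eqP; rewrite sqrf_eq0 => /eqP ->; rewrite ltxx.
Qed.

Lemma omega_neq0 : w != 0.
Proof.
apply/eqP => w0; have := prim_expr_order (omega_prim).
by rewrite w0 expr0n /= => /eqP; rewrite eq_sym oner_eq0.
Qed.

Lemma omega_sum (a b : 'I_N) :
  \sum_(k < N) w ^+ (a * k) * (w ^+ (b * k))^-1 = (a == b)%:R * N%:R.
Proof.
have [<-|neq] := eqVneq a b.
  rewrite mul1r (eq_bigr (fun=> 1)) ?sumr_const ?card_ord // => k _.
  by rewrite divff // expf_neq0 // omega_neq0.
set z := w ^+ a / w ^+ b.
rewrite (eq_bigr (fun k : 'I_N => z ^+ k)); last first.
  by move=> k _; rewrite exprMn exprVn -!exprM.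
rewrite mul0r; have zN : z ^+ N = 1.
  rewrite exprMn exprVn -!exprM ![(_ * N)%N]mulnC !exprM.
  by rewrite (prim_expr_order omega_prim) !expr1n divr1.
apply/eqP; have := subrX1 z N; rewrite zN subrr => /esym/eqP.
rewrite mulf_eq0 => /orP[|//]; rewrite subr_eq0 => /eqP z1; case/negP: neq.
have : w ^+ a == w ^+ b.
  apply/eqP; rewrite -[RHS]mul1r -z1 divfK // expf_neq0 // omega_neq0 //.
by rewrite (eq_prim_root_expr omega_prim) !modn_small.
Qed.

Lemma conj_omega : w^*%C = w^-1.
Proof.
apply: (mulfI omega_neq0); rewrite divff ?omega_neq0 //.
rewrite /omega; set t := _ / _.
have := cos2Dsin2 t; rewrite !expr2 => ct.
apply/eqP; rewrite eq_complex /=; apply/andP; split; apply/eqP.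
  by rewrite opprK mulNr opprK.
by ring.
Qed.

Lemma conj_omegaX m : ((w ^+ m)^* = (w ^+ m)^-1)%C.
Proof. by rewrite rmorphXn -exprVn -conj_omega. Qed.

Lemma omegaN (k : 'I_N) q : w ^+ (q * (- k)%R) = (w ^+ (q * k))^-1.
Proof.
have wX0 j := expf_neq0 j omega_neq0; apply: (mulIf (wX0 (q * k)%N)).
rewrite mulVf ?wX0 // -exprD -mulnDr.
have /dvdnP[c ->] : (N %| (- k)%R + k)%N.
  by rewrite /dvdn /= modnDml subnK ?modnn // ltnW.
by rewrite mulnA exprM exprAC (prim_expr_order omega_prim) expr1n.
Qed.

Lemma dft_conj l p (A : tensor R l p N) (k : 'I_N) :
  dft A (- k) = map_mx (@conjc R) (dft A k).
Proof.
rewrite !ffunE; apply/matrixP => i j; rewrite mxE !summxE rmorph_sum.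
apply: eq_bigr => q _; rewrite !mxE rmorphM omegaN.
by congr (_ * _); [rewrite -conj_omegaX | rewrite /= oppr0].
Qed.

Lemma idftK l p (H : tensor R[i] l p N) :
  (forall k, H (- k) = map_mx (@conjc R) (H k)) -> dft (idft H) = H.
Proof.
move=> Hc; pose G (k : 'I_N) : 'M[R[i]]_(l, p) :=
  N%:R^-1 *: \sum_(j < N) (w ^+ (j * k))^-1 *: H j.
have Greal k : map_mx (fun x : R => x%:C) (map_mx (@complex.Re R) (G k)) = G k.
  have Gc : map_mx (@conjc R) (G k) = G k.
    rewrite /G map_mxZ; congr (_ *: _); first by rewrite fmorphV rmorph_nat.
    rewrite raddf_sum /= (reindex_inj oppr_inj) /=.
    apply: eq_bigr => j _; rewrite map_mxZ Hc mulnC omegaN [(k * j)%N]mulnC.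
    rewrite -map_mx_comp /= map_mx_id => [|x]; last exact: conjcK.
    by rewrite invrK conj_omegaX.
  apply/matrixP => i j; rewrite mxE [X in X%:C]mxE.
  have := congr1 (fun M => fun_of_matrix M i j) Gc; rewrite [LHS]mxE.
  case: (G k i j) => a b /= [bN]; rewrite (_ : b = 0) //; lra.
apply/ffunP => k; rewrite ffunE.
under eq_bigr => j _ do rewrite ffunE Greal.
under eq_bigr => j _ do rewrite /G scalerA mulrC -scalerA scaler_sumr.
rewrite -scaler_sumr exchange_big /=.
under eq_bigr => j _.
  under eq_bigr => q _ do rewrite scalerA [(q * k)%N]mulnC.
  rewrite -scaler_suml omega_sum.
  over.
rewrite (bigD1 k) //= eqxx mul1r big1 => [|j /negPf jk].
  by rewrite addr0 scalerA mulVf ?scale1r // pnatr_eq0.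
by rewrite eq_sym jk mul0r scale0r.
Qed.

Lemma dft_tprod l q p (A : tensor R l q N) (B : tensor R q p N) (i : 'I_N) :
  dft (tprod A B) i = dft A i *m dft B i.
Proof.
by rewrite /tprod idftK => [|k]; rewrite [LHS]ffunE // [in RHS]ffunE !dft_conj map_mxM.
Qed.

Lemma dft_tubeprod l p (b : tensor R 1 1 N) (A : tensor R l p N) (i : 'I_N) :
  dft (tubeprod b A) i = dft b i 0 0 *: dft A i.
Proof.
rewrite /tubeprod idftK => [|k]; rewrite [LHS]ffunE //.
by rewrite [in RHS]ffunE !dft_conj map_mxZ mxE.
Qed.

Lemma dft_ttrans l p (A : tensor R l p N) (i : 'I_N) :
  dft (ttrans A) i = (dft A i)^t*.
Proof.
rewrite !ffunE [in LHS](reindex_inj oppr_inj) /=.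
apply/matrixP => a b; rewrite !mxE !summxE rmorph_sum.
apply: eq_bigr => q _; rewrite !mxE !ffunE !mxE opprK.
rewrite mulnC omegaN rmorphM [(q * i)%N]mulnC.
by congr (_ * _); [exact: esym (conj_omegaX _) | rewrite /= /Num.conj /= oppr0].
Qed.

Lemma dftK l p : cancel (@dft R l p n) (@idft R l p n).
Proof.
move=> A; apply/ffunP => k; rewrite ffunE.
under eq_bigr => j _.
  rewrite ffunE scaler_sumr.
  under eq_bigr => q _ do rewrite scalerA mulrC [(j * k)%N]mulnC.
  over.
rewrite exchange_big /=.
under eq_bigr => q _ do rewrite -scaler_suml omega_sum.
rewrite (bigD1 k) //= eqxx mul1r big1 => [|j /negPf ->]; last first.
  by rewrite mul0r scale0r.
rewrite addr0 scalerA mulVf ?scale1r ?pnatr_eq0 //.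
by apply/matrixP => a b; rewrite !mxE.
Qed.

End DftFacts.

(* Main.v *)
Require Import Defs.
From mathcomp Require Import all_boot all_order all_algebra.
From mathcomp Require Import all_classical all_reals all_analysis.
From mathcomp Require Import complex.
Local Open Scope ring_scope.
Set Implicit Arguments.
Unset Strict Implicit.
Unset Printing Implicit Defensive.
Import Order.TTheory GRing.Theory Num.Theory.
Local Open Scope sesquilinear_scope.

(* In each Fourier component let [u_j] be a left singular vector of
   [B, beta e], let [s_j] be its singular value, and let [v_j = P B^-1 u_j] be
   the harmonic Ritz vector. Multiplying [B B^* u_j + |beta|^2 e e^* u_j =
   s_j^2 u_j] by [P B^-1] gives [A^* (Q u_j) = s_j^2 v_j + (e^* u_j) x] with
   [x = r - |beta|^2 P B^-1 e] independent of [j], while [A v_j = Q u_j].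
   Hence if [Pc] is the orthonormal factor in a QR factorization of
   [v_1, ..., v_k, x], and [Qc], [Bc] are the factors of a QR factorization of
   [A Pc], then the first [k] columns of [Qc] span the [Q u_j], and [A^*] maps
   them into the range of [Pc], so the residual [A^* Qc - Pc Bc^*] is
   concentrated in its last column. No division by [beta] occurs, so the case
   [beta = 0] needs no separate treatment, and [beta_(k+1)] can be taken to be
   the identity tube. The QR factors of conjugate Fourier slices are chosen
   conjugate to each other, and real where a slice is its own conjugate, so
   that they come from real tensors. *)

(** * QR factorization of complex matrices, keeping real matrices real *)

Lemma adjmxM (C : numClosedFieldType) m n p (A : 'M[C]_(m, n)) (B : 'M[C]_(n, p)) :
  (A *m B)^t* = B^t* *m A^t*.
Proof. by rewrite trmx_mul map_mxM. Qed.

Lemma adjmx_pid (C : numClosedFieldType) m n r :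
  (pid_mx r : 'M[C]_(m, n))^t* = pid_mx r.
Proof. by rewrite tr_pid_mx map_pid_mx. Qed.

Lemma adjmx_conj (C : numClosedFieldType) m n (A : 'M[C]_(m, n)) :
  (map_mx Num.conj A)^t* = map_mx Num.conj (A^t*).
Proof. by rewrite map_trmx. Qed.

(** The factor is the inverse of the Euclidean norm; being real, it keeps real vectors real. *)
Lemma normalize_real (C : numClosedFieldType) l (y : 'cV[C]_l) :
  y != 0 ->
  exists2 c : C, c != 0 & (c *: y)^t* *m (c *: y) = 1%:M /\ c^* = c.
Proof.
move=> y0; pose s := \sum_i `|y i 0| ^+ 2.
have s_ge0 : 0 <= s by apply: sumr_ge0 => i _; rewrite exprn_ge0.
have s_gt0 : 0 < s.
  rewrite lt_neqAle s_ge0 andbT eq_sym; apply: contra y0.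
  rewrite psumr_eq0 => [/allP s0|i _]; last by rewrite exprn_ge0.
  apply/eqP/matrixP => i j; rewrite ord1 mxE; apply/eqP.
  by have := s0 i (mem_index_enum _); rewrite /= expf_eq0 normr_eq0.
have q_gt0 : 0 < sqrtC s by rewrite sqrtC_gt0.
have qV : ((sqrtC s)^-1)^* = (sqrtC s)^-1.
  by rewrite conj_Creal // rpredV ger0_real // ltW.
exists (sqrtC s)^-1; first by rewrite invr_eq0 gt_eqF.
split=> //; apply/matrixP => i j; rewrite !ord1 !mxE eqxx.
under eq_bigr => a _.
  by rewrite !mxE rmorphM /= qV mulrACA [_^* * _]mulrC -normCK -expr2 over.
by rewrite -mulr_sumr exprVn sqrtCK mulVf // gt_eqF.
Qed.

(** One Gram-Schmidt step: [v] is the normalized projection of [u] onto the orthogonal complement of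
    the range of [Q]. If that projection vanishes, the projection of a basis vector replaces it. *)
Lemma orthonormal_extend (C : numClosedFieldType) l q (Q : 'M[C]_(l, q))
    (u : 'cV[C]_l) :
  (q < l)%N -> Q^t* *m Q = 1%:M ->
  exists v : 'cV[C]_l,
    [/\ Q^t* *m v = 0, v^t* *m v = 1%:M,
        Q *m (Q^t* *m u) + v *m (v^t* *m u) = u &
        map_mx Num.conj Q = Q -> map_mx Num.conj u = u -> map_mx Num.conj v = v].
Proof.
move=> ltql QQ; pose E := 1%:M - Q *m Q^t*.
have QE w : Q^t* *m (E *m w) = 0 :> 'cV_q.
  by rewrite mulmxA mulmxBr mulmx1 mulmxA QQ mul1mx subrr mul0mx.
have Ereal (w : 'cV_l) : map_mx Num.conj Q = Q -> map_mx Num.conj w = w ->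
    map_mx Num.conj (E *m w) = E *m w.
  move=> Qr wr; rewrite map_mxM wr map_mxB map_mx1 map_mxM -adjmx_conj.
  by rewrite Qr.
pose spec (y : 'cV[C]_l) := [/\ y != 0, Q^t* *m y = 0,
  exists c : C, E *m u = c *: y &
  map_mx Num.conj Q = Q -> map_mx Num.conj u = u -> map_mx Num.conj y = y].
have [y [y0 Qy [c Eu] yr]] : exists y, spec y.
  have [Eu0|Eu0] := eqVneq (E *m u) 0; last first.
    by exists (E *m u); split=> //; [exists 1; rewrite scale1r | apply: Ereal].
  (* If [E] killed every basis vector, [Q *m Q^t*] would be the identity of rank [l], but its rank
     is at most [q < l]. *)
  have [i Ei0] : exists i, E *m delta_mx i (0 : 'I_1) != 0.
    apply/existsP; apply: contraLR ltql => /existsPn Ei; rewrite -leqNgt.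
    have E0 : E = 0.
      apply/matrixP => a b; have /negbNE/eqP := Ei b.
      by rewrite -colE => /matrixP/(_ a 0); rewrite !mxE.
    have <- : \rank (1%:M : 'M[C]_l) = l by rewrite mxrank1.
    move/eqP: E0; rewrite subr_eq0 => /eqP ->.
    exact: leq_trans (mxrankM_maxl _ _) (rank_leq_col _).
  exists (E *m delta_mx i 0); split=> //.
    by exists 0; rewrite Eu0 scale0r.
  by move=> Qr _; apply: Ereal => //; rewrite map_delta_mx.
have [d d0 [vv dr]] := normalize_real y0; set v := d *: y in vv.
have Qv : Q^t* *m v = 0 by rewrite -scalemxAr Qy scaler0.
have vQ : v^t* *m Q = 0.
  by rewrite -[Q]trmxCK -adjmxM Qv trmx0 map_mx0.
exists v; split=> //.
  have Ev : E *m u = v *m (c / d)%:M.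
    by rewrite mul_mx_scalar scalerA divfK.
  have uE : u = Q *m (Q^t* *m u) + v *m (c / d)%:M.
    by rewrite -Ev mulmxBl mul1mx mulmxA addrC subrK.
  rewrite [in RHS]uE {2}uE; congr (_ + v *m _).
  by rewrite mulmxDr mulmxA vQ mul0mx add0r mulmxA vv mul1mx.
by move=> Qr ur; rewrite map_mxZ /= dr yr.
Qed.

(** Gram-Schmidt from the last column to the first. The vector added for [M1] is orthogonal to [Q2],
    whose range contains the columns of [M2]; hence the zero upper right block. *)
Lemma ql_factorization (C : numClosedFieldType) l q (M : 'M[C]_(l, q)) :
  (q <= l)%N ->
  exists Q : 'M[C]_(l, q),
    [/\ Q^t* *m Q = 1%:M, Q *m (Q^t* *m M) = M, is_trig_mx (Q^t* *m M) &
        map_mx Num.conj M = M -> map_mx Num.conj Q = Q].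
Proof.
elim: q M => [|q IH]; last rewrite -(add1n q); move=> M leql.
  by exists M; split=> //; [apply/matrixP => -[] | apply/matrixP => ? []
    | apply/is_trig_mxP => -[]].
have [M1 [M2 MM]] : exists (M1 : 'M[C]_(l, 1)) (M2 : 'M[C]_(l, q)),
    M = row_mx M1 M2 by exists (lsubmx M), (rsubmx M); rewrite hsubmxK.
have [Q2 [QQ QM QT Qr]] := IH M2 (ltnW leql).
have [v [Qv vv vM vr]] := orthonormal_extend M1 leql QQ.
have vQ : v^t* *m Q2 = 0 by rewrite -[Q2]trmxCK -adjmxM Qv trmx0 map_mx0.
have adjE : (row_mx v Q2)^t* = col_mx (v^t*) (Q2^t*).
  by rewrite tr_row_mx map_col_mx.
have TE : (row_mx v Q2)^t* *m M =
    block_mx (v^t* *m M1) 0 (Q2^t* *m M1) (Q2^t* *m M2).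
  rewrite adjE MM mul_col_row; congr (block_mx _ _ _ _).
  by rewrite -QM mulmxA vQ mul0mx.
exists (row_mx v Q2); split.
- by rewrite adjE mul_col_row QQ Qv vQ vv -scalar_mx_block.
- rewrite TE mul_row_block mulmx0 add0r QM MM; congr row_mx.
  by rewrite addrC.
- by rewrite TE is_trig_block_mx // eqxx QT andbT; apply/is_trig_mxP => i j;
    rewrite !ord1.
rewrite MM !map_row_mx => /eq_row_mx[M1r M2r].
by rewrite vr ?Qr.
Qed.

(** Reversing the order of the columns turns the lower triangular factor of [ql_factorization] into
    an upper triangular one. *)
Lemma qr_factorization (C : numClosedFieldType) l q (M : 'M[C]_(l, q)) :
  (q <= l)%N ->
  exists Q : 'M[C]_(l, q),
    [/\ Q^t* *m Q = 1%:M, Q *m (Q^t* *m M) = M,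
        forall i j : 'I_q, (j < i)%N -> (Q^t* *m M) i j = 0 &
        map_mx Num.conj M = M -> map_mx Num.conj Q = Q].
Proof.
move=> leql; pose rev p (X : 'M[C]_(p, q)) := colsub (@rev_ord q) X.
have [Q [QQ QM /is_trig_mxP QT Qr]] := ql_factorization (rev l M) leql.
exists (rev l Q); split.
- apply/matrixP => i j; have /matrixP/(_ (rev_ord i) (rev_ord j)) := QQ.
  rewrite !mxE (inj_eq rev_ord_inj) => <-.
  by apply: eq_bigr => a _; rewrite !mxE.
- apply/matrixP => i j; have /matrixP/(_ i (rev_ord j)) := QM.
  rewrite !mxE rev_ordK => <-; rewrite [LHS](reindex_inj rev_ord_inj) /=.
  apply: eq_bigr => a _; rewrite !mxE rev_ordK; congr (_ * _).
  by apply: eq_bigr => b _; rewrite !mxE !rev_ordK.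
- move=> i j ltji; rewrite -[RHS](QT (rev_ord i) (rev_ord j)); last first.
    by rewrite /= ltn_sub2l // (leq_ltn_trans ltji).
  by rewrite !mxE; apply: eq_bigr => a _; rewrite !mxE rev_ordK.
move=> Mr; have {}Qr := Qr _; rewrite -[in RHS]Qr; last first.
  by apply/matrixP => i j; have /matrixP/(_ i (rev_ord j)) := Mr; rewrite !mxE.
by apply/matrixP => i j; rewrite !mxE.
Qed.

(** * Leading columns and leading blocks *)

Lemma mul_colsub_pid (C : numClosedFieldType) m n k (h : (k <= n)%N)
    (X : 'M[C]_(m, n)) :
  X *m (pid_mx k : 'M[C]_(n, k)) = colsub (widen_ord h) X.
Proof.
rewrite -[X in RHS]mulmx1 -mulmx_colsub; congr (_ *m _).
by apply/matrixP => i j; rewrite !mxE -[i == _]val_eqE /= andb_idr // => /eqP ->.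
Qed.

Lemma pid_mul_tr (C : numClosedFieldType) n k : (k <= n)%N ->
  (pid_mx k : 'M[C]_(k, n)) *m (pid_mx k : 'M[C]_(n, k)) = 1%:M.
Proof. by move=> h; rewrite pid_mx_id // pid_mx_1. Qed.

(** The left inverse of [X] makes the square factor [T] invertible, so [X] and [Y] have the same
    column span. *)
Lemma factor_left_inverse (C : numClosedFieldType) m k (X Y : 'M[C]_(m, k))
    (T : 'M[C]_k) (L : 'M[C]_(k, m)) :
  X = Y *m T -> L *m X = 1%:M -> Y = X *m (L *m Y).
Proof.
move=> XE LX; have TL : T *m (L *m Y) = 1%:M.
  by apply: mulmx1C; rewrite -mulmxA -XE.
by rewrite {1}XE -mulmxA TL mulmx1.
Qed.

(** The span of the first [k] basis vectors is invariant under an upper triangular matrix, which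
    acts there by its leading block. *)
Lemma upper_pid (C : numClosedFieldType) k (T : 'M[C]_k.+1) :
  (forall i j : 'I_k.+1, (j < i)%N -> T i j = 0) ->
  let J := pid_mx k : 'M[C]_(k.+1, k) in
  T *m J = J *m (J^T *m T *m J).
Proof.
move=> Tu /=; rewrite tr_pid_mx !mulmxA pid_mx_id //.
apply/matrixP => i j; rewrite !(mul_colsub_pid (leqnSn k)) !mxE.
have [iltk|keqi] := ltnP i k.
  rewrite (bigD1 i) //= big1 => [|a /negPf ai]; rewrite !mxE /=.
    by rewrite eqxx iltk mul1r addr0.
  by rewrite -val_eqE /= in ai; rewrite eq_sym ai mul0r.
rewrite Tu /=; last exact: leq_trans (ltn_ord j) keqi.
by rewrite big1 // => a _; rewrite mxE ltnNge keqi andbF mul0r.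
Qed.

Lemma diag_pid (C : numClosedFieldType) m k (D : 'M[C]_m) :
  (k <= m)%N -> is_diag_mx D ->
  let W := pid_mx k : 'M[C]_(m, k) in
  D *m W = W *m (W^T *m D *m W).
Proof.
move=> lekm /is_diag_mxP Dd /=; rewrite tr_pid_mx !mulmxA pid_mx_id //.
apply/matrixP => i j; rewrite !(mul_colsub_pid lekm) !mxE.
have [iltk|keqi] := ltnP i k.
  rewrite (bigD1 i) //= big1 => [|a /negPf ai]; rewrite !mxE /=.
    by rewrite eqxx iltk mul1r addr0.
  by rewrite -val_eqE /= in ai; rewrite eq_sym ai mul0r.
rewrite Dd /=; last by rewrite neq_ltn (leq_trans (ltn_ord j) keqi) orbT.
by rewrite big1 // => a _; rewrite mxE ltnNge keqi andbF mul0r.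
Qed.

Lemma pid_last (C : numClosedFieldType) k :
  let J := pid_mx k : 'M[C]_(k.+1, k) in
  let f := delta_mx 0 ord_max : 'rV[C]_k.+1 in
  [/\ J *m J^T + f^T *m f = 1%:M, f *m J = 0 & f *m f^T = 1%:M].
Proof.
split.
- rewrite tr_pid_mx pid_mx_id // trmx_delta mul_delta_mx.
  apply/matrixP => i j; rewrite !mxE -!val_eqE /=.
  have [->|/eqP ij] := eqVneq (i : nat) j.
    have [jk|] := ltnP j k; first by rewrite ltn_eqF //= addr0.
    by move=> kj; rewrite eqn_leq -ltnS ltn_ord kj /= add0r.
  rewrite /= add0r; case: andP => // -[/eqP ik /eqP jk].
  by rewrite ik jk in ij.
- apply/matrixP => i j; rewrite (mul_colsub_pid (leqnSn k)) !mxE.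
  by rewrite ord1 -[widen_ord _ _ == _]val_eqE /= ltn_eqF.
by rewrite trmx_delta mul_delta_mx; apply/matrixP => i j; rewrite !ord1 !mxE.
Qed.

(** * The restarted factorization in one Fourier component *)

Section RestartedFactorization.
Variables (C : numClosedFieldType) (l p k : nat) (A : 'M[C]_(l, p)).
Variables (V : 'M[C]_(p, k)) (Y : 'M[C]_(l, k)) (x : 'cV[C]_p).
Variables (D : 'M[C]_k) (g : 'rV[C]_k) (L : 'M[C]_(k, p)).
Hypotheses (AV : A *m V = Y) (AY : A^t* *m Y = V *m D + x *m g).
Hypotheses (YY : Y^t* *m Y = 1%:M) (LV : L *m V = 1%:M).

Local Notation J := (pid_mx k : 'M[C]_(k.+1, k)).
Local Notation f := (delta_mx 0 ord_max : 'rV[C]_k.+1).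

Variables (Pc : 'M[C]_(p, k.+1)) (Rc Bc : 'M[C]_k.+1) (Qc : 'M[C]_(l, k.+1)).
Hypotheses (PcPc : Pc^t* *m Pc = 1%:M) (QcQc : Qc^t* *m Qc = 1%:M).
Hypothesis PcRc : V *m J^T + x *m f = Pc *m Rc.
Hypothesis QcBc : A *m Pc = Qc *m Bc.
Hypothesis Rcu : forall i j : 'I_k.+1, (j < i)%N -> Rc i j = 0.
Hypothesis Bcu : forall i j : 'I_k.+1, (j < i)%N -> Bc i j = 0.

Let Rk := J^T *m Rc *m J.

(** [J] picks the first [k] columns and [f^T] the last, so [PcRc] is a QR factorization of [V] with
    [x] appended. *)
Lemma leading_ritz : V = Pc *m Rc *m J.
Proof.
have [_ fJ _] := pid_last C k.
rewrite -PcRc mulmxDl -(mulmxA x) fJ mulmx0 addr0 -mulmxA tr_pid_mx.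
by rewrite pid_mul_tr // mulmx1.
Qed.

Lemma leading_ritz_factor : V = Pc *m J *m Rk.
Proof. by rewrite leading_ritz -mulmxA (upper_pid Rcu) mulmxA. Qed.

(** This is the slicewise form of the t-linear combinations: the left inverse [L] makes the leading
    block [Rk] invertible. *)
Lemma leading_lincomb : Pc *m J = V *m (L *m (Pc *m J)).
Proof. exact: factor_left_inverse leading_ritz_factor LV. Qed.

(** Consequently [Pc *m Bc^t*] is the orthogonal projection of [A^t* *m Qc] onto the range of
    [Pc]. *)
Lemma adj_triangular_factor : Bc^t* = Pc^t* *m (A^t* *m Qc).
Proof.
have -> : Bc = Qc^t* *m (A *m Pc) by rewrite QcBc mulmxA QcQc mul1mx.
by rewrite !adjmxM trmxCK mulmxA.
Qed.

(** The projection fixes the range of [Pc], so it suffices that [A^t*] maps the first [k] columns of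
    [Qc] into it. The changes of basis [G1] and [G2] express these columns through [Y]. *)
Lemma residual_leading : (A^t* *m Qc - Pc *m Bc^t*) *m J = 0.
Proof.
have [JJ fJ ff] := pid_last C k.
have Jf : J^T *m f^T = 0 by rewrite -trmx_mul fJ trmx0.
set G1 := L *m (Pc *m J).
have RG : Rk *m G1 = 1%:M.
  by apply: mulmx1C; rewrite /G1 -mulmxA -leading_ritz_factor.
have APJ : A *m (Pc *m J) = Y *m G1 by rewrite leading_lincomb mulmxA AV.
have APJ' : A *m (Pc *m J) = Qc *m J *m (J^T *m Bc *m J).
  by rewrite mulmxA QcBc -mulmxA (upper_pid Bcu) mulmxA.
(* [Y^t*] undoes the orthonormal [Y], and [Rk] undoes [G1]. *)
pose L2 := Rk *m Y^t*.
have L2A : L2 *m (A *m (Pc *m J)) = 1%:M.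
  by rewrite APJ /L2 -mulmxA (mulmxA (Y^t*)) YY mul1mx.
have := factor_left_inverse APJ' L2A.
set G2 := L2 *m _; rewrite APJ -mulmxA => QcJ.
have xE : x = Pc *m (Rc *m f^T).
  by rewrite mulmxA -PcRc mulmxDl -!mulmxA ff mulmx1 Jf mulmx0 add0r.
have [Z AZ] : exists Z, A^t* *m (Qc *m J) = Pc *m Z.
  (* Obtained from [AY] by substituting [V = Pc *m Rc *m J] and [x = Pc *m Rc *m f^T]. *)
  exists ((Rc *m J *m D + Rc *m f^T *m g) *m (G1 *m G2)).
  rewrite QcJ mulmxA AY [RHS]mulmxA mulmxDr !(mulmxA Pc) -leading_ritz.
  by rewrite -[Pc *m Rc *m _]mulmxA -xE.
rewrite mulmxBl adj_triangular_factor -!mulmxA AZ.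
by rewrite (mulmxA (Pc^t*)) PcPc mul1mx subrr.
Qed.

(** Splitting the identity as in [pid_last] leaves only the last column of the residual; as a
    remainder of a projection, it is orthogonal to [Pc]. *)
Lemma residual_last :
  let w := (A^t* *m Qc - Pc *m Bc^t*) *m f^T in
  A^t* *m Qc = Pc *m Bc^t* + w *m f /\ Pc^t* *m w = 0.
Proof.
have [JJ _ _] := pid_last C k; split.
  apply/eqP; rewrite addrC -subr_eq; apply/eqP.
  by rewrite -[LHS]mulmx1 -JJ mulmxDr !mulmxA residual_leading mul0mx add0r.
rewrite mulmxA mulmxBr -adj_triangular_factor mulmxA.
by rewrite PcPc mul1mx subrr mul0mx.
Qed.

End RestartedFactorization.

(** * Harmonic Ritz vectors in one Fourier component *)

Section LanczosRitz.
Variables (C : numClosedFieldType) (l p m k : nat) (lekm : (k <= m)%N).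
Variables (A : 'M[C]_(l, p)) (P : 'M[C]_(p, m)) (Q : 'M[C]_(l, m)).
Variables (B Binv U D : 'M[C]_m) (r : 'cV[C]_p) (e : 'cV[C]_m) (b : 'M[C]_1).
Hypotheses (PP : P^t* *m P = 1%:M) (QQ : Q^t* *m Q = 1%:M).
Hypotheses (AP : A *m P = Q *m B) (AQ : A^t* *m Q = P *m B^t* + r *m e^t*).
Hypotheses (BBinv : B *m Binv = 1%:M) (UU : U^t* *m U = 1%:M).
Hypotheses (BBU : B *m B^t* *m U + e *m b *m e^t* *m U = U *m D).
Hypothesis Ddiag : is_diag_mx D.

Local Notation W := (pid_mx k : 'M[C]_(m, k)).

Lemma mul_A_ritz : A *m (P *m Binv *m U *m W) = Q *m U *m W.
Proof. by rewrite !mulmxA AP -(mulmxA Q) BBinv mulmx1. Qed.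

(** Here [b] stands for [|beta|^2]. Applying [Binv] to [BBU] yields [B^t* *m U], and diagonality of
    [D] allows the restriction to the first [k] columns. *)
Lemma mul_adjA_ritz :
  A^t* *m (Q *m U *m W) =
  P *m Binv *m U *m W *m (W^T *m D *m W) +
  (r - P *m Binv *m e *m b) *m (e^t* *m U *m W).
Proof.
have BU : B^t* *m U = Binv *m (U *m D - e *m b *m e^t* *m U).
  by rewrite -BBU addrK !mulmxA (mulmx1C BBinv) mul1mx.
rewrite -mulmxA -(mulmxA _ W) -(diag_pid lekm Ddiag).
rewrite !mulmxA AQ -mulmxDl; congr (_ *m _).
rewrite mulmxDl -mulmxA BU mulmxBr mulmxBr mulmxBl !mulmxA.
by rewrite [in RHS]mulmxBl -addrA [X in _ + X = _]addrC.
Qed.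

Lemma ritz_left_inverse :
  W^T *m U^t* *m B *m P^t* *m (P *m Binv *m U *m W) = 1%:M.
Proof.
rewrite -!mulmxA (mulmxA (P^t*)) PP mul1mx (mulmxA B) BBinv mul1mx.
by rewrite (mulmxA (U^t*)) UU mul1mx tr_pid_mx pid_mul_tr.
Qed.

Lemma image_ritz_orthonormal : (Q *m U *m W)^t* *m (Q *m U *m W) = 1%:M.
Proof.
rewrite !adjmxM adjmx_pid -!mulmxA (mulmxA (Q^t*)) QQ mul1mx.
by rewrite (mulmxA (U^t*)) UU mul1mx pid_mul_tr.
Qed.

End LanczosRitz.

(** Both sides are [M *m M^t* *m U] for the bordered matrix [M], expanded once by blocks and once
    through its singular value decomposition. *)
Lemma gram_append (C : numClosedFieldType) m (B U : 'M[C]_m) (S : 'M[C]_(m, m + 1))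
    (V : 'M[C]_(m + 1)) (e : 'cV[C]_m) (b : 'M[C]_1) :
  U \is unitarymx -> V \is unitarymx ->
  row_mx B (b 0 0 *: e) = U *m S *m V^t* ->
  B *m B^t* *m U + e *m (b *m b^t*) *m e^t* *m U = U *m (S *m S^t*).
Proof.
move=> /unitarymxP UU /unitarymxP VV BE.
have -> : e *m (b *m b^t*) *m e^t* = (b 0 0 *: e) *m (b 0 0 *: e)^t*.
  by rewrite -mul_mx_scalar -mx11_scalar adjmxM !mulmxA.
rewrite -mulmxDl -mul_row_col.
have -> : col_mx (B^t*) ((b 0 0 *: e)^t*) = (row_mx B (b 0 0 *: e))^t*.
  by rewrite tr_row_mx map_col_mx.
rewrite BE !adjmxM trmxCK -!mulmxA (mulmx1C UU) mulmx1 (mulmxA (V^t*)).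
by rewrite (mulmx1C VV) mul1mx.
Qed.

Lemma diag_mul_adj (C : numClosedFieldType) m n (S : 'M[C]_(m, n)) :
  is_diag_mx S -> is_diag_mx (S *m S^t*).
Proof.
move=> /is_diag_mxP Sd; apply/is_diag_mxP => i j ij; rewrite mxE big1 // => a _.
rewrite !mxE; have [ia|ia] := eqVneq (i : nat) a.
  by rewrite [S j a]Sd ?conjC0 ?mulr0 // -ia eq_sym.
by rewrite Sd ?mul0r.
Qed.

(** * Passing between tensors and their Fourier slices *)

Section TensorDft.
Variables (R : realType) (n : nat).

Lemma dft_inj l p (X Y : tensor R l p n.+1) :
  (forall q, dft X q = dft Y q) -> X = Y.
Proof. by move=> XY; rewrite -[X]dftK -[Y]dftK; congr idft; apply/ffunP. Qed.

Lemma dftD l p (X Y : tensor R l p n.+1) q : dft (X + Y) q = dft X q + dft Y q.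
Proof.
by rewrite !ffunE -big_split; apply: eq_bigr => a _; rewrite ffunE map_mxD scalerDr.
Qed.

Lemma dftB l p (X Y : tensor R l p n.+1) q : dft (X - Y) q = dft X q - dft Y q.
Proof. by rewrite -[in RHS](subrK Y X) [in RHS]dftD addrK. Qed.

Lemma dft0 l p q : dft (0 : tensor R l p n.+1) q = 0.
Proof. by rewrite -(subrr 0) dftB subrr. Qed.

Lemma dft_sum l p I (s : seq I) (F : I -> tensor R l p n.+1) q :
  dft (\sum_(i <- s) F i) q = \sum_(i <- s) dft (F i) q.
Proof.
by elim/big_rec2: _ => [|i X Y _ <-]; rewrite ?dft0 ?dftD.
Qed.

Lemma dft_mxsub l p l' p' (f : 'I_l' -> 'I_l) (g : 'I_p' -> 'I_p)
    (X : tensor R l p n.+1) q :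
  dft ([ffun a => mxsub f g (X a)] : tensor R l' p' n.+1) q = mxsub f g (dft X q).
Proof.
rewrite !ffunE; apply/matrixP => i j; rewrite !mxE !summxE.
by apply: eq_bigr => a _; rewrite ffunE !mxE.
Qed.

Lemma dft_lateral l p (j : 'I_p) (X : tensor R l p n.+1) q :
  dft (lateral j X) q = col j (dft X q).
Proof.
rewrite !ffunE; apply/matrixP => i a; rewrite !mxE !summxE.
by apply: eq_bigr => b _; rewrite ffunE !mxE.
Qed.

Lemma dft_trow l p p' (X : tensor R l p n.+1) (Y : tensor R l p' n.+1) q :
  dft (trow X Y) q = row_mx (dft X q) (dft Y q).
Proof.
rewrite !ffunE; apply/matrixP => i j; rewrite mxE summxE.
by case: split_ordP => a ->; rewrite summxE; apply: eq_bigr => b _;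
  rewrite ffunE !mxE ?(unsplitK (inl _)) ?(unsplitK (inr _)).
Qed.

(** Every Fourier slice of this tensor is [X] itself, so it lifts constant selection matrices to
    tensors. *)
Definition tslice0 {l p} (X : 'M[R]_(l, p)) : tensor R l p n.+1 :=
  [ffun q => if q == 0 then X else 0].

Lemma dft_tslice0 l p (X : 'M[R]_(l, p)) q :
  dft (tslice0 X) q = map_mx (fun x : R => x%:C%C) X.
Proof.
rewrite ffunE (bigD1 0) //= big1 => [|a /negPf a0].
  by rewrite ffunE eqxx mul0n expr0 scale1r addr0.
by rewrite ffunE a0 map_mx0 scaler0.
Qed.

Lemma dft_tid m q : dft (tid R m n) q = 1%:M.
Proof. by rewrite (dft_tslice0 1%:M) map_mx1. Qed.

Lemma dft_tE j q : dft (tE R j.+1 n) q = delta_mx ord_max 0.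
Proof.
have -> : tE R j.+1 n = tslice0 (delta_mx ord_max 0).
  apply/ffunP => a; rewrite !ffunE; apply/matrixP => i b; rewrite mxE !ord1.
  by case: (a == 0); rewrite !mxE ?eqxx ?andbT.
by rewrite dft_tslice0 map_delta_mx.
Qed.

Lemma dft_tpid l p k q : dft (tslice0 (pid_mx k : 'M[R]_(l, p))) q = pid_mx k.
Proof. by rewrite dft_tslice0 map_pid_mx. Qed.

Lemma dft_mul_ttrans_tE l j (x : tensor R l 1 n.+1) q :
  dft (tprod x (ttrans (tE R j.+1 n))) q = dft x q *m delta_mx 0 ord_max.
Proof. by rewrite dft_tprod dft_ttrans dft_tE trmx_delta map_delta_mx. Qed.

Lemma dft_mul_ttrans_tpid l m k (V : tensor R l k n.+1) q :
  dft (tprod V (ttrans (tslice0 (pid_mx k : 'M[R]_(m, k))))) q =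
  dft V q *m (pid_mx k : 'M[R[i]]_(m, k))^T.
Proof. by rewrite dft_tprod dft_ttrans dft_tpid adjmx_pid tr_pid_mx. Qed.

(* One slice out of each pair [k], [- k] is chosen freely and the other is its
   conjugate; a slice with [- k = k] has to be real. *)
Lemma tensor_choice l p (spec : 'I_n.+1 -> 'M[R[i]]_(l, p) -> Prop) :
  (forall k X, spec k X -> spec (- k) (map_mx Num.conj X)) ->
  (forall k, exists X, spec k X /\ (- k = k -> map_mx Num.conj X = X)) ->
  exists T : tensor R l p n.+1, forall k, spec k (dft T k).
Proof.
move=> specN /choice[F FP].
pose H : tensor R[i] l p n.+1 :=
  [ffun k : 'I_n.+1 => if (k <= - k)%N then F k else map_mx Num.conj (F (- k))].
have Hc k : H (- k) = map_mx (@conjc R) (H k).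
  rewrite !ffunE opprK.
  have [lt_kNk|lt_Nkk|eq_kNk] := ltngtP (k : nat) (- k)%R.
  - by [].
  - by rewrite -map_mx_comp map_mx_id // => z; apply: conjCK.
  have kN : - k = k by apply/val_inj.
  by rewrite kN; exact: esym ((FP k).2 kN).
exists (idft H) => k; rewrite idftK // ffunE; case: ifP => _; first exact: (FP k).1.
by rewrite -{1}[k]opprK; apply: specN (FP _).1.
Qed.

Lemma upper_triangular_dft m (T : tensor R m m n.+1) :
  (forall q (i j : 'I_m), (j < i)%N -> dft T q i j = 0) -> upper_triangular T.
Proof.
move=> Tu i j q ji; rewrite -[T]dftK ffunE mxE [X in complex.Re X]mxE summxE.
by rewrite big1 ?mulr0 // => a _; rewrite mxE Tu // mulr0.
Qed.

Lemma torthonormalP l j (X : tensor R l j n.+1) :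
  torthonormal X <-> forall q, (dft X q)^t* *m dft X q = 1%:M.
Proof.
split=> [XX q|XX]; first by rewrite -dft_ttrans -dft_tprod XX dft_tid.
by apply: dft_inj => q; rewrite dft_tprod dft_ttrans dft_tid.
Qed.

(** Conjugating a QR factor of slice [k] gives one for slice [- k], and [qr_factorization] respects
    realness; these are the premises of [tensor_choice]. *)
Lemma tensor_qr l p (M : tensor R l p n.+1) : (p <= l)%N ->
  exists (Q : tensor R l p n.+1) (T : tensor R p p n.+1),
    [/\ torthonormal Q, M = tprod Q T &
        forall q (i j : 'I_p), (j < i)%N -> dft T q i j = 0].
Proof.
move=> lepl.
pose spec k (Q : 'M[R[i]]_(l, p)) :=
  [/\ Q^t* *m Q = 1%:M, Q *m (Q^t* *m dft M k) = dft M k &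
      forall i j : 'I_p, (j < i)%N -> (Q^t* *m dft M k) i j = 0].
have MN k : dft M (- k) = map_mx Num.conj (dft M k) by exact: dft_conj.
have [k X|k|Q QP] := tensor_choice (spec := spec).
- rewrite /spec MN adjmx_conj -!map_mxM => -[-> -> Xu].
  by rewrite map_mx1; split=> // i j ji; rewrite mxE Xu // rmorph0.
- have [Q [QQ QM Qu Qr]] := qr_factorization (dft M k) lepl.
  by exists Q; split=> // kN; apply: Qr; rewrite -MN kN.
exists Q, (tprod (ttrans Q) M); split.
- by apply/torthonormalP => q; case: (QP q).
- by apply: dft_inj => q; rewrite !dft_tprod dft_ttrans; case: (QP q).
by move=> q i j ji; rewrite dft_tprod dft_ttrans; case: (QP q) => _ _ ->.
Qed.

End TensorDft.

(** * Assembling the restarted tensor factorization *)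

Theorem theorem11 (R : realType) (l p m n : nat)
    (A : tensor R l p n.+1)
    (hm : (m <= minn l p)%N)
    (P : tensor R p m n.+1) (Q : tensor R l m n.+1)
    (B : tensor R m m n.+1) (r : tensor R p 1 n.+1)
    (hP : torthonormal P) (hQ : torthonormal Q)
    (hPr : torthogonal P r) (hB : upper_bidiagonal B)
    (hAP : tprod A P = tprod Q B)
    (hAQ : tprod (ttrans A) Q =
           tprod P (ttrans B) + tprod r (ttrans (tE R m n)))
    (beta : tensor R 1 1 n.+1)
    (hbeta : forall i : 'I_n.+1, dft beta i 0 0 = norm2 (dft r i))
    (Binv : tensor R m m n.+1) (hBinv : is_tinv B Binv)
    (U' : tensor R m m n.+1) (S' : tensor R m (m + 1) n.+1)
    (V' : tensor R (m + 1) (m + 1) n.+1)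
    (hsvd : is_tsvd (trow B (tubeprod beta (tE R m n))) U' S' V')
    (hord : smallest_first S')
    (k : nat) (hk1 : (1 <= k)%N) (hkm : (k < m)%N) :
  exists (Pc : tensor R p k.+1 n.+1) (Qc : tensor R l k.+1 n.+1)
         (Bc : tensor R k.+1 k.+1 n.+1) (betac : tensor R 1 1 n.+1)
         (pc : tensor R p 1 n.+1),
    torthonormal Pc /\ torthonormal Qc /\
    upper_triangular Bc /\
    torthogonal Pc pc /\
    tprod A Pc = tprod Qc Bc /\
    tprod (ttrans A) Qc =
      tprod Pc (ttrans Bc) +
      tprod (tubeprod betac pc) (ttrans (tE R k.+1 n)) /\
    forall j : 'I_k,
      is_tlincomb
        (fun i : 'I_k => harmonic_ritz P Binv U' (widen_ord (ltnW hkm) i))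
        (lateral (widen_ord (leqnSn k) j) Pc).
Proof.
have lekm := ltnW hkm.
move: hm; rewrite leq_min => /andP[leml lemp].
pose W := tslice0 n (pid_mx k : 'M[R]_(m, k)).
pose J := tslice0 n (pid_mx k : 'M[R]_(k.+1, k)).
(* [V] collects the first [k] harmonic Ritz slices, and [L] will be its left inverse. *)
pose V := tprod (tprod (tprod P Binv) U') W.
pose x := r - tprod (tprod (tprod P Binv) (tE R m n)) (tprod beta (ttrans beta)).
pose L := tprod (tprod (tprod (ttrans W) (ttrans U')) B) (ttrans P).
(* [N] is [V] with [x] appended. Selection tensors give it [k.+1] columns, where [trow] would give
   [k + 1], a different type. *)
pose N := tprod V (ttrans J) + tprod x (ttrans (tE R k.+1 n)).
have [Pc [Rc [PcPc NE Rcu]]] := tensor_qr N (leq_trans hkm lemp).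
have [Qc [Bc [QcQc AE Bcu]]] :=
  tensor_qr (tprod A Pc) (leq_trans hkm leml).
pose E := tprod (ttrans A) Qc - tprod Pc (ttrans Bc).
have /torthonormalP hPq := hP; have /torthonormalP hQq := hQ.
have /torthonormalP PcPcq := PcPc; have /torthonormalP QcQcq := QcQc.
have VE q : dft V q =
    dft P q *m dft Binv q *m dft U' q *m (pid_mx k : 'M[R[i]]_(m, k)).
  by rewrite !dft_tprod dft_tpid.
have LE q : dft L q =
    (pid_mx k : 'M[R[i]]_(m, k))^T *m (dft U' q)^t* *m dft B q *m (dft P q)^t*.
  by rewrite !dft_tprod !dft_ttrans dft_tpid adjmx_pid tr_pid_mx.
(* [D] will be the leading block of [S *m S^t*] and [g] the first [k] entries of [e^t* *m U], in the
   Fourier component [q]. *)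
have slice q : exists (D : 'M[R[i]]_k) (g : 'rV[R[i]]_k),
  [/\ dft A q *m dft V q = dft Q q *m dft U' q *m pid_mx k,
      (dft A q)^t* *m (dft Q q *m dft U' q *m pid_mx k) =
        dft V q *m D + dft x q *m g,
      (dft Q q *m dft U' q *m pid_mx k)^t* *m
        (dft Q q *m dft U' q *m (pid_mx k : 'M[R[i]]_(m, k))) = 1%:M &
      dft L q *m dft V q = 1%:M].
  have [U'u V'u S'd _] := hsvd q; rewrite dft_trow dft_tubeprod => BE.
  have UU := mulmx1C (elimT unitarymxP U'u).
  have BB : dft B q *m dft Binv q = 1%:M.
    by rewrite -dft_tprod (proj1 hBinv) dft_tid.
  have AP : dft A q *m dft P q = dft Q q *m dft B q.
    by rewrite -!dft_tprod hAP.
  have AQ : (dft A q)^t* *m dft Q q =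
      dft P q *m (dft B q)^t* + dft r q *m (dft (tE R m n) q)^t*.
    by rewrite -!dft_ttrans -!dft_tprod hAQ dftD.
  have BBU := gram_append U'u V'u BE.
  have xE : dft x q = dft r q - dft P q *m dft Binv q *m dft (tE R m n) q *m
      (dft beta q *m (dft beta q)^t*).
    by rewrite dftB !dft_tprod dft_ttrans.
  do 2!eexists; split.
  - by rewrite VE; exact: mul_A_ritz AP BB.
  - rewrite VE xE.
    exact (mul_adjA_ritz lekm AQ BB BBU (diag_mul_adj S'd)).
  - exact (image_ritz_orthonormal lekm (hQq q) UU).
  - by rewrite VE LE; exact (ritz_left_inverse lekm (hPq q) BB UU).
clearbody V x L.
have NEq q : dft V q *m (pid_mx k : 'M[R[i]]_(k.+1, k))^T +
    dft x q *m delta_mx 0 ord_max = dft Pc q *m dft Rc q.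
  transitivity (dft N q); last by rewrite NE dft_tprod.
  rewrite [RHS]dftD; congr (_ + _); apply: esym.
    exact: dft_mul_ttrans_tpid.
  exact: dft_mul_ttrans_tE.
have AEq q : dft A q *m dft Pc q = dft Qc q *m dft Bc q.
  by rewrite -!dft_tprod AE.
have Ecol q : dft (lateral ord_max E) q =
    ((dft A q)^t* *m dft Qc q - dft Pc q *m (dft Bc q)^t*) *m
      (delta_mx 0 ord_max)^T.
  rewrite [LHS]dft_lateral colE trmx_delta; congr (_ *m _).
  by rewrite [LHS]dftB; congr (_ - _); rewrite [LHS]dft_tprod dft_ttrans.
have last q : (dft A q)^t* *m dft Qc q = dft Pc q *m (dft Bc q)^t* +
      dft (lateral ord_max E) q *m delta_mx 0 ord_max /\
    (dft Pc q)^t* *m dft (lateral ord_max E) q = 0.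
  have [D [g [AV AY YY LV]]] := slice q; rewrite Ecol.
  exact (residual_last AV AY YY LV (PcPcq q) (QcQcq q) (NEq q) (AEq q)
    (Rcu q) (Bcu q)).
clearbody E.
(* The last residual slice is taken unnormalized, so the tube in front of it is the identity. *)
exists Pc, Qc, Bc, (tid R 1 n), (lateral ord_max E).
split; first exact: PcPc.
split; first exact: QcQc.
split; first exact: upper_triangular_dft.
split.
  by apply: dft_inj => q; rewrite dft_tprod dft_ttrans dft0; case: (last q).
split; first exact: AE.
split.
  apply: dft_inj => q; have [AQc _] := last q.
  rewrite [LHS]dft_tprod dft_ttrans AQc [RHS]dftD.
  rewrite [X in _ = X + _]dft_tprod dft_ttrans; congr (_ + _).
  rewrite [RHS]dft_mul_ttrans_tE; congr (_ *m _).
  by rewrite dft_tubeprod dft_tid mxE eqxx scale1r.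
(* [c] lifts the coefficients of [leading_lincomb] to tensors; the constant index maps cut out its
   tube [(i, j)]. *)
move=> j; pose c := tprod L (tprod Pc J).
exists (fun i => [ffun a => mxsub (fun=> i) (fun=> j) (c a)]).
apply: dft_inj => q; rewrite dft_lateral dft_sum.
have [D [g [AV AY YY LV]]] := slice q.
have PcJ := leading_lincomb LV (NEq q) (Rcu q).
have -> : col (widen_ord (leqnSn k) j) (dft Pc q) =
    col j (dft V q *m dft c q).
  rewrite !dft_tprod dft_tpid -PcJ.
  by apply/matrixP => a b; rewrite (mul_colsub_pid (leqnSn k)) !mxE.
apply/matrixP => a b; rewrite ord1 mxE [LHS]mxE summxE; apply: eq_bigr => i _.
rewrite dft_tubeprod dft_mxsub /harmonic_ritz !dft_tprod dft_lateral.
rewrite VE (mul_colsub_pid (ltnW hkm)) !mxE mulrC; congr (_ * _).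
by apply: eq_bigr => d _; rewrite [X in _ = _ * X]mxE.
Qed.
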